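(* Let $\mathcal{G}=(\mathcal{S},\mathbb{A})$ be a finite graded pointed DAG with initial state $s_0$, set of terminating states $\mathcal{X}$ and set of complete trajectories $\mathcal{T}$, and let $R:\mathcal{X}\to(0,\infty)$ be a reward function. Let $P_F=P_F(\cdot\mid\cdot\,;\theta)$ be a forward policy with parameters $\theta$ and $P_B=P_B(\cdot\mid\cdot\,;\phi)$ a backward policy with parameters $\phi$; the transition probabilities are assumed strictly positive on all edges of $\mathcal{G}$ and differentiable in $\theta$ and $\phi$ respectively ($P_F$ does not depend on $\phi$, and $P_B$ does not depend on $\theta$). Let $Z>0$ be any scalar that does not depend on $\theta$, on $\phi$, or on the trajectory. For $\tau\in\mathcal{T}$ let $$\mathcal{L}_{\rm TB}(\tau)=\left(\log\frac{Z\,P_F(\tau)}{R(x_\tau)\,P_B(\tau\mid x_\tau)}\right)^2 .$$ Then $$\nabla_\phi D_{\rm KL}(P_B\|P_F)=\frac12\,\mathbb{E}_{\tau\sim P_B}\left[\nabla_\phi\mathcal{L}_{\rm TB}(\tau)\right],\qquad \nabla_\theta D_{\rm KL}(P_F\|P_B)=\frac12\,\mathbb{E}_{\tau\sim P_F}\left[\nabla_\theta\mathcal{L}_{\rm TB}(\tau)\right],$$ where $P_F$ and $P_B$ inside the KL divergences and expectations denote the induced distributions over $\mathcal{T}$, and on the right-hand sides the gradient is taken of $\mathcal{L}_{\rm TB}(\tau)$ for fixed $\tau$ (not through the sampling distribution).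
   Context: A pointed DAG is a finite directed acyclic graph $\mathcal{G}=(\mathcal{S},\mathbb{A})$ with exactly one state $s_0$ (the initial state) having no incoming edge. States with no outgoing edges are called terminating; $\mathcal{X}$ is the set of terminating states. If $s\to s'$ is an edge, $s$ is a parent of $s'$ and $s'$ a child of $s$. A complete trajectory is a directed path $\tau=(s_0\to s_1\to\dots\to s_n)$ with $s_n\in\mathcal{X}$; $\mathcal{T}$ is the set of complete trajectories and $x_\tau=s_n$ denotes the last state of $\tau$. A pointed DAG is graded if all complete trajectories have the same length; equivalently, $\mathcal{S}=\bigsqcup_{l=0}^L\mathcal{S}_l$ with $\mathcal{S}_0=\{s_0\}$, $\mathcal{S}_L=\mathcal{X}$, and every edge goes from some $\mathcal{S}_i$ to $\mathcal{S}_{i+1}$. A forward policy $P_F(\cdot\mid s)$ is, for every non-terminating state $s$, a probability distribution over the children of $s$. A backward policy $P_B(\cdot\mid s)$ is, for every $s\neq s_0$, a probability distribution over the parents of $s$. The forward policy induces a distribution over complete trajectories, $P_F(\tau)=\prod_{i=0}^{n-1}P_F(s_{i+1}\mid s_i)$. For the backward policy, $P_B(\tau\mid x_\tau)=\prod_{(s\to s')\in\tau}P_B(s\mid s')$, and the induced distribution over complete trajectories is $P_B(\tau)=R(x_\tau)P_B(\tau\mid x_\tau)/\hat Z$ with $\hat Z=\sum_{x\in\mathcal{X}}R(x)$. $D_{\rm KL}(P\|Q)=\sum_{\tau\in\mathcal{T}}P(\tau)\log\frac{P(\tau)}{Q(\tau)}$ is the Kullback–Leibler divergence between distributions on the finite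 set $\mathcal{T}$. *)

(* Defs.v *)
From HB Require Import structures.
From mathcomp Require Import all_boot all_order all_algebra.
From mathcomp Require Import all_classical all_reals all_analysis.

Set Implicit Arguments.
Unset Strict Implicit.
Unset Printing Implicit Defensive.

Import Order.TTheory GRing.Theory Num.Theory.
Import numFieldNormedType.Exports.

Local Open Scope ring_scope.

(* [cycle edge c] says that c is a closed walk; it holds vacuously of [::]. *)
Record pointedDAG := PointedDAG {
  state :> finType;
  edge : rel state;
  init : state;
  edge_acyclic : forall c : seq state, cycle edge c -> c = [::];
  init_unique_source :
    forall s : state, [forall s', ~~ edge s' s] = (s == init) }.

Arguments edge {_}.
Arguments init {_}.

Section Trajectories.
Variable G : pointedDAG.

Definition terminating (s : G) : bool := [forall s', ~~ edge s s'].

(* The trajectory s_0 -> s_1 -> ... -> s_n is encoded by the sequence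
   [:: s_1; ...; s_n]; the initial state is left implicit. *)
Definition complete_traj (t : seq G) : bool :=
  path edge init t && terminating (last init t).

Lemma edge_path_uniq (x : G) (t : seq G) : path edge x t -> uniq (x :: t).
Proof.
elim: t x => [//|y t IHt] x xt.
have /andP[_ yt] : edge x y && path edge y t by [].
rewrite cons_uniq (IHt _ yt) andbT; apply/negP => xyt; move: xt.
case/splitPr: xyt => p1 p2; rewrite -cat_rcons cat_path => /andP[cyc _].
by have /edge_acyclic : cycle edge (x :: p1) by [].
Qed.

Lemma size_complete_traj (t : seq G) :
  complete_traj t -> (size t <= #|G|)%N.
Proof.
move=> /andP[/edge_path_uniq t_uniq _].
by apply: ltnW; rewrite -[_.+1]/(size (init :: t)) -(card_uniqP t_uniq) max_card.
Qed.

(* By [size_complete_traj], the size bound excludes no complete trajectory. *)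
Definition trajectories : {set #|G|.-bseq G} :=
  [set t : #|G|.-bseq G | complete_traj t]%SET.

Definition graded : Prop :=
  forall t1 t2 : seq G,
    complete_traj t1 -> complete_traj t2 -> size t1 = size t2.

Section Policies.
Variable R : realType.

(* Both kinds of policy are functions of an edge s -> s': a forward policy has
   PF s s' = P_F(s' | s), whereas a backward policy has PB s s' = P_B(s | s').
   Their values off the edges are irrelevant. *)
Definition forward_policy (PF : G -> G -> R) : Prop :=
  forall s, ~~ terminating s ->
    (forall s', edge s s' -> 0 <= PF s s') /\
    \sum_(s' | edge s s') PF s s' = 1.

Definition backward_policy (PB : G -> G -> R) : Prop :=
  forall s', s' != init ->
    (forall s, edge s s' -> 0 <= PB s s') /\
    \sum_(s | edge s s') PB s s' = 1.

(* P_F(tau) for a forward policy, P_B(tau | x_tau) for a backward policy. *)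
Definition traj_prod (P : G -> G -> R) (t : seq G) : R :=
  \prod_(e <- zip (init :: t) t) P e.1 e.2.

Definition forward_law (PF : G -> G -> R) (t : seq G) : R := traj_prod PF t.

Definition total_reward (r : G -> R) : R := \sum_(x | terminating x) r x.

Definition backward_law (r : G -> R) (PB : G -> G -> R) (t : seq G) : R :=
  r (last init t) * traj_prod PB t / total_reward r.

Definition KL (P Q : seq G -> R) : R :=
  \sum_(t in trajectories) P t * ln (P t / Q t).

Definition traj_expectation (V : lmodType R) (P : seq G -> R) (F : seq G -> V) : V :=
  \sum_(t in trajectories) P t *: F t.

Definition loss_TB (Z : R) (r : G -> R) (PF PB : G -> G -> R) (t : seq G) : R :=
  ln (Z * traj_prod PF t / (r (last init t) * traj_prod PB t)) ^+ 2.

End Policies.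
End Trajectories.

Definition gradient (R : realType) (n : nat) (f : 'rV[R]_n -> R)
    (x : 'rV[R]_n) : 'rV[R]_n :=
  \row_i 'D_(delta_mx 0 i) f x.

(* Main.v *)
(* Up to sign, the logarithm inside the loss is [ln (c * (P t / Q t))], where P
   is the law being differentiated, Q the other one, and [c] is Z / Zhat or its
   inverse.  Hence half the P-expectation of the gradient of the loss is
   [\sum_t (ln c + ln (P t / Q t)) *: grad P t], while the gradient of the
   divergence is [\sum_t (1 + ln (P t / Q t)) *: grad P t]; they agree because
   the total mass of P is constantly 1, so that [\sum_t grad P t = 0]. *)
Require Import Defs.
From HB Require Import structures.
From mathcomp Require Import all_boot all_order all_algebra.
From mathcomp Require Import all_classical all_reals all_analysis.
From mathcomp Require Import ring.

Set Implicit Arguments.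
Unset Strict Implicit.
Unset Printing Implicit Defensive.

Import Order.TTheory GRing.Theory Num.Theory.
Import numFieldNormedType.Exports.
Local Open Scope ring_scope.

(** * Maximal paths of a finite relation and their total weight *)

Section MaximalPaths.
Variables (T : finType) (e : rel T).

Definition sink (s : T) : bool := [forall s', ~~ e s s'].

Definition maximal_path (s : T) (t : seq T) : bool :=
  path e s t && sink (last s t).

(** The fuel [n] makes the recursion structural. Fuel exhausted at a non-sink yields no path at all,
    so every listed path is maximal. *)
Fixpoint maximal_paths (n : nat) (s : T) : seq (seq T) :=
  if sink s then [:: [::]] else
  if n is n'.+1 then
    [seq s' :: t | s' <- enum (e s), t <- maximal_paths n' s']
  else [::].

Lemma maximal_path_nil (s : T) : maximal_path s [::] = sink s.
Proof. by []. Qed.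

Lemma maximal_path_cons (s s' : T) (t : seq T) :
  maximal_path s (s' :: t) = e s s' && maximal_path s' t.
Proof. by rewrite /maximal_path /= andbA. Qed.

Lemma mem_maximal_paths (n : nat) (s : T) (t : seq T) :
  (t \in maximal_paths n s) = maximal_path s t && (size t <= n)%N.
Proof.
have sink_nil s' t' : sink s' -> maximal_path s' t' = (t' == [::]).
  move=> s'_sink; case: t' => [|y t']; first by rewrite maximal_path_nil.
  by rewrite maximal_path_cons (negbTE (forallP s'_sink y)).
elim: n s t => [|n IHn] s t /=; case: ifPn => s_sink.
- by rewrite mem_seq1 sink_nil//; case: t.
- by case: t => [|y t]; rewrite ?andbF// maximal_path_nil (negbTE s_sink).
- by rewrite mem_seq1 sink_nil//; case: t.
- apply/allpairsPdep/idP => [[y [w [ey /[!IHn] /andP[yw wn] ->]]]|].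
    by move: ey; rewrite mem_enum maximal_path_cons yw /= andbT ltnS wn andbT.
  case: t => [|y w]; first by rewrite maximal_path_nil (negbTE s_sink).
  rewrite maximal_path_cons => /andP[/andP[ey yw] wn].
  by exists y, w; rewrite mem_enum IHn yw.
Qed.

Lemma maximal_paths_uniq (n : nat) (s : T) : uniq (maximal_paths n s).
Proof.
elim: n s => [|n IHn] s /=; case: ifP => // _.
apply: allpairs_uniq_dep => [|//|[y w] [z w'] _ _ /= [-> ->] //].
exact: enum_uniq.
Qed.

Definition path_weight (R : realType) (P : T -> T -> R) (s : T) (t : seq T) : R :=
  \prod_(a <- zip (s :: t) t) P a.1 a.2.

Lemma path_weight_cons (R : realType) (P : T -> T -> R) (s s' : T) (t : seq T) :
  path_weight P s (s' :: t) = P s s' * path_weight P s' t.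
Proof. by rewrite /path_weight /= big_cons. Qed.

(** Once the first step is split off, the tails after each successor sum to 1 by induction, and the
    weights [P s s'] that remain sum to 1 as well. The bound on path lengths keeps the fuel from
    running out. *)
Lemma sum_maximal_paths (R : realType) (P : T -> T -> R) (n : nat) (s : T) :
  (forall s, ~~ sink s -> \sum_(s' | e s s') P s s' = 1) ->
  (forall t, path e s t -> (size t <= n)%N) ->
  \sum_(t <- maximal_paths n s) path_weight P s t = 1.
Proof.
move=> P1; elim: n s => [|n IHn] s short_paths /=; case: ifPn => s_sink.
- by rewrite big_seq1 /path_weight big_nil.
(* Without fuel, an edge out of [s] would be a path of length 1, above the bound 0. *)
- case/forallPn: s_sink => y /negPn sy.
  by have := short_paths [:: y]; rewrite /= sy => /(_ isT).
- by rewrite big_seq1 /path_weight big_nil.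
rewrite big_allpairs_dep big_enum /= -[RHS](P1 s s_sink).
apply: eq_bigr => y sy; under eq_bigr do rewrite path_weight_cons.
rewrite -mulr_sumr IHn ?mulr1// => t yt.
by apply: (short_paths (y :: t)); rewrite /= yt andbT.
Qed.

End MaximalPaths.

(** * Reversal of walks *)

Lemma path_weight_rcons (T : finType) (R : realType) (P : T -> T -> R)
    (s y : T) (t : seq T) :
  path_weight P s (rcons t y) = path_weight P s t * P (last s t) y.
Proof.
elim: t s => [|z t IHt] s; first by rewrite /= path_weight_cons mulrC.
by rewrite rcons_cons !path_weight_cons IHt mulrA.
Qed.

(** A walk is stored as its start [s] and its later vertices [t]. Read backwards it starts at
    [last s t] and continues with [rev (belast s t)]; this lemma and the next make that operation an
    involution. *)
Lemma last_rev_belast (T : Type) (s : T) (t : seq T) :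
  last (last s t) (rev (belast s t)) = s.
Proof. by case: t => //= y t; rewrite rev_cons last_rcons. Qed.

Lemma rev_belastK (T : Type) (s : T) (t : seq T) :
  rev (belast (last s t) (rev (belast s t))) = t.
Proof.
by case: t => //= y t; rewrite rev_cons belast_rcons rev_cons revK -lastI.
Qed.

Lemma path_weight_rev (T : finType) (R : realType) (P : T -> T -> R)
    (s : T) (t : seq T) :
  path_weight P (last s t) (rev (belast s t)) = path_weight (fun a b => P b a) s t.
Proof.
elim: t s => [|y t IHt] s; first by rewrite /path_weight !big_nil.
by rewrite /= rev_cons path_weight_rcons last_rev_belast IHt path_weight_cons mulrC.
Qed.

(** * Total mass of the laws on complete trajectories *)

(** Lets each law be summed along a list adapted to its own recursion. *)
Lemma big_trajectories (R : realType) (G : pointedDAG) (ts : seq (seq G))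
    (F : seq G -> R) :
  uniq ts -> ts =i @complete_traj G ->
  \sum_(t in trajectories G) F t = \sum_(t <- ts) F t.
Proof.
move=> ts_uniq tsE.
rewrite -big_enum -(big_map val xpredT F); apply: perm_big; apply: uniq_perm => //.
  by rewrite map_inj_uniq ?enum_uniq//; exact: val_inj.
move=> t; rewrite tsE; apply/mapP/idP => [[b + ->]|tc].
  by rewrite mem_enum inE.
by exists (Bseq (size_complete_traj tc)); rewrite ?mem_enum ?inE.
Qed.

(** Complete trajectories are the maximal paths from [init], and acyclicity bounds their length by
    the number of states, which serves as fuel. *)
Lemma sum_forward_law (R : realType) (G : pointedDAG) (PF : G -> G -> R) :
  forward_policy PF -> \sum_(t in trajectories G) forward_law PF t = 1.
Proof.
move=> PFp; rewrite (big_trajectories (ts := maximal_paths edge #|G| init)).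
- apply: sum_maximal_paths => [s /PFp[]//|t /edge_path_uniq t_uniq].
  by apply: ltnW; rewrite -[_.+1]/(size (init :: t)) -(card_uniqP t_uniq) max_card.
- exact: maximal_paths_uniq.
- move=> t; rewrite mem_maximal_paths; apply/andP/idP => [[]//|tc].
  by split=> //; exact: size_complete_traj.
Qed.

(* Reversal turns a complete trajectory ending at x into a maximal path from x
   along reversed edges, whose only sink is the initial state. *)
Lemma sum_backward_law (R : realType) (G : pointedDAG) (r : G -> R)
    (PB : G -> G -> R) :
  backward_policy PB -> total_reward r != 0 ->
  \sum_(t in trajectories G) backward_law r PB t = 1.
Proof.
move=> PBp r_neq0; pose e' : rel G := fun s s' => edge s' s.
have sinkE s : sink e' s = (s == init) by rewrite -init_unique_source.
have rev_pathE s t : path e' s t = path edge (last s t) (rev (belast s t)).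
  by rewrite rev_path.
have short_paths s t : path e' s t -> (size t <= #|G|)%N.
  rewrite rev_pathE => /edge_path_uniq t_uniq.
  apply: ltnW; rewrite -(size_belast s) -size_rev.
  by rewrite -[_.+1]/(size (last s t :: _)) -(card_uniqP t_uniq) max_card.
(* Grouping by the final state [x] makes each inner sum of backward probabilities 1, so that the
   rewards add up to [total_reward r]. *)
pose ts := [seq rev (belast x w) | x <- enum (@terminating G),
                                   w <- maximal_paths e' #|G| x].
have last_init x w : w \in maximal_paths e' #|G| x -> last x w = init.
  by rewrite mem_maximal_paths => /andP[/andP[_]]; rewrite sinkE => /eqP.
rewrite (big_trajectories (ts := ts)).
- rewrite big_allpairs_dep big_enum /= -(mulfV r_neq0) [X in _ = X * _]/total_reward.
  rewrite mulr_suml; apply: eq_bigr => x _.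
  rewrite -[r x in RHS]mulr1.
  rewrite -(sum_maximal_paths (e := e') (P := fun a b => PB b a) (n := #|G|) (s := x)).
  + rewrite mulr_sumr mulr_suml; apply: eq_big_seq => w /last_init xw.
    rewrite /backward_law -xw last_rev_belast; congr (_ * _ / _).
    by rewrite /traj_prod -xw -path_weight_rev.
  + by move=> s; rewrite sinkE => /PBp[].
  + exact: short_paths.
- apply: allpairs_uniq_dep => [|x _|[x w] [y w']].
  + exact: enum_uniq.
  + exact: maximal_paths_uniq.
  + move=> /allpairsPdep[x0 [w0 [_ /last_init xw [-> ->]]]].
    move=> /allpairsPdep[y0 [w0' [_ /last_init yw [-> ->]]]] /= eq_rev.
    (* Followed from [init], the reversed walk ends at the original start, so equal reversals come
       from the same [x]. *)
    have eq_x : x0 = y0.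
      by rewrite -(last_rev_belast x0 w0) xw eq_rev -yw last_rev_belast.
    have : x0 :: w0 = y0 :: w0'.
      by rewrite !lastI xw yw; congr rcons; exact: (can_inj revK).
    by case=> -> ->.
- move=> t; apply/allpairsPdep/idP => [[x [w [xX xw ->]]]|].
    have xwi := last_init _ _ xw; move: xw; rewrite mem_maximal_paths => /andP[/andP[xw _] _].
    rewrite mem_enum in xX.
    by rewrite unfold_in /complete_traj -xwi -rev_pathE xw last_rev_belast.
  rewrite unfold_in => /andP[it lt].
  exists (last init t), (rev (belast init t)); split; rewrite ?mem_enum//.
    have e't : path e' (last init t) (rev (belast init t)).
      by rewrite rev_path.
    by rewrite mem_maximal_paths (short_paths _ _ e't) /maximal_path e't last_rev_belast sinkE eqxx.
  by rewrite rev_belastK.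
Qed.

(** * Differentials of logarithms, sums and products *)

Lemma is_diff_ln (R : realType) (V : normedModType R) (f df : V -> R) (x : V) :
  0 < f x -> is_diff x f df ->
  is_diff x (fun u => ln (f u)) (fun v => (f x)^-1 * df v).
Proof.
move=> fx_gt0 fd.
have [lnD ln'E] := is_derive1_ln fx_gt0.
have lnd : is_diff (f x) (@ln R) ( *%R (f x)^-1).
  apply: DiffDef; first exact/derivable1_diffP.
  move/derivable1_diffP : lnD => lnD; apply/funext => h.
  (* A linear map on [R] is determined by its value at 1, here the derivative of [ln]. *)
  by rewrite -[h in LHS]mulr1 -[h * 1]/(h *: 1) linearZ /= -deriveE// ln'E mulrC.
exact: (is_diff_comp fd lnd).
Qed.

Lemma is_diff_big_sum (R : realType) (V : normedModType R) (I : Type)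
    (s : seq I) (p : pred I) (f df : I -> V -> R) (x : V) :
  (forall i, p i -> is_diff x (f i) (df i)) ->
  is_diff x (fun u => \sum_(i <- s | p i) f i u)
            (fun v => \sum_(i <- s | p i) df i v).
Proof.
move=> fd; elim: s => [|i s IHs].
  have sum0 (g : I -> V -> R) : (fun u => \sum_(i <- [::] | p i) g i u) = cst 0.
    by apply/funext => u; rewrite big_nil.
  by rewrite !sum0; exact: is_diff_cst.
have sumS (g : I -> V -> R) : (fun u => \sum_(j <- i :: s | p j) g j u) =
    (if p i then g i else cst 0) + (fun u => \sum_(j <- s | p j) g j u).
  by apply/funext => u; rewrite big_cons fctE; case: ifP; rewrite ?add0r.
rewrite !sumS; apply: is_diffD => //.
by case: ifP => [/fd //|_]; exact: is_diff_cst.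
Qed.

Lemma differentiable_big_prod (R : realType) (V : normedModType R)
    (I : eqType) (s : seq I) (f : I -> V -> R) (x : V) :
  {in s, forall i, differentiable (f i) x} ->
  differentiable (fun u => \prod_(i <- s) f i u) x.
Proof.
elim: s => [|i s IHs] fd.
  by under eq_fun do rewrite big_nil; exact: differentiable_cst.
under eq_fun do rewrite big_cons.
apply: differentiableM; first by apply: fd; rewrite mem_head.
by apply: IHs => j js; apply: fd; rewrite inE js orbT.
Qed.

Lemma is_diff_gradient (R : realType) (n : nat) (f df : 'rV[R]_n -> R)
    (x : 'rV[R]_n) :
  is_diff x f df -> gradient f x = \row_i df (delta_mx 0 i).
Proof.
by move=> fd; apply/rowP => i; rewrite !mxE deriveE// diff_val.
Qed.

(** * Gradient of the divergence in its first argument *)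

(** Serves both laws in the role of [P]. The mass is required to be 1 near [x], not only at [x],
    because its derivative at [x] has to vanish. *)
Lemma KL_gradient (R : realType) (G : pointedDAG) (n : nat)
    (P : 'rV[R]_n -> seq G -> R) (Q : seq G -> R) (x : 'rV[R]_n) (c : R) :
  0 < c ->
  (forall t, t \in trajectories G ->
     [/\ 0 < P x t, 0 < Q t & differentiable (P ^~ t) x]) ->
  (\forall u \near x, \sum_(t in trajectories G) P u t = 1) ->
  let logratio u t := ln (c * (P u t / Q t)) in
  [/\ differentiable (fun u => KL (P u) Q) x,
      forall t, t \in trajectories G ->
        differentiable (fun u => logratio u t ^+ 2) x
    & gradient (fun u => KL (P u) Q) x = 2^-1 *:
        traj_expectation (P x) (fun t => gradient (fun u => logratio u t ^+ 2) x)].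
Proof.
move=> c_gt0 PQ sumP logratio; pose d t := 'd (P ^~ t) x : _ -> R.
have dP t : t \in trajectories G -> is_diff x (P ^~ t) (d t).
  by case/PQ => _ _ Pd; exact: differentiableP.
(* The factor [a] only adds the constant [ln a] and so drops out of the differential. The case
   [a = 1] serves the divergence, [a = c] the loss. *)
have dln a t : 0 < a -> t \in trajectories G ->
    is_diff x (fun u => ln (a * (P u t / Q t))) (fun v => (P x t)^-1 * d t v).
  move=> a_gt0 tG; have [Pt_gt0 Qt_gt0 _] := PQ t tG.
  have aPQ_gt0 : 0 < a * (P x t / Q t) by rewrite mulr_gt0// divr_gt0.
  have aPQd : is_diff x (fun u => a * (P u t / Q t)) (fun v => a / Q t * d t v).
    rewrite (_ : (fun u => _) = a / Q t *: (P ^~ t)).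
      exact: (is_diffZ (a / Q t) (dP t tG)).
    by apply/funext => u; rewrite mulrCA mulrC.
  apply: (is_diff_eq (is_diff_ln (f := fun u => a * (P u t / Q t)) aPQ_gt0 aPQd)).
  by apply/funext => v; field; rewrite !gt_eqF.
have dKL : is_diff x (fun u => KL (P u) Q) (fun v =>
    \sum_(t in trajectories G) (d t v + ln (P x t / Q t) * d t v)).
  apply: is_diff_big_sum => t tG; have [Pt_gt0 _ _] := PQ t tG.
  have := dln 1 t ltr01 tG.
  under eq_fun do rewrite mul1r.
  move=> lnd; apply: (is_diff_eq (f := P ^~ t * _) (is_diffM (dP t tG) lnd)).
  apply/funext => v; rewrite !fctE /= /GRing.scale/=.
  by rewrite mulrA mulfV ?mul1r// gt_eqF.
have dloss t : t \in trajectories G -> is_diff x (fun u => logratio u t ^+ 2)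
    (fun v => 2 * logratio x t * ((P x t)^-1 * d t v)).
  (* The argument [1] of [is_diffX] encodes the exponent 2. *)
  by move=> tG; exact: (is_diffX 1 (dln c t c_gt0 tG)).
split; [exact: ex_diff | by move=> t /dloss ?; exact: ex_diff |].
rewrite (is_diff_gradient dKL).
apply/rowP => i; rewrite /traj_expectation !mxE summxE mulr_sumr.
(* The mass of [P u] is constant near [x], so its score has mean zero. *)
have d_sum0 : \sum_(t in trajectories G) d t (delta_mx 0 i) = 0.
  have dsum := is_diff_big_sum (index_enum _) dP.
  have := congr1 (fun g : 'rV_n => g 0 i) (is_diff_gradient dsum).
  by rewrite /= !mxE => <-; rewrite (near_eq_derive _ sumP) derive_cst.
apply/eqP; rewrite -subr_eq0 -sumrB; apply/eqP.
(* Splitting off [ln c] from the log ratio makes the terms in [ln (P x t / Q t)] cancel for each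
   [t], which leaves [1 - ln c] times the differential. *)
transitivity ((1 - ln c) * \sum_(t in trajectories G) d t (delta_mx 0 i)).
  rewrite mulr_sumr; apply: eq_bigr => t tG; have [Pt_gt0 Qt_gt0 _] := PQ t tG.
  rewrite (is_diff_gradient (dloss t tG)) !mxE /logratio.
  rewrite (lnM (x := c)) ?posrE ?divr_gt0//.
  by field; rewrite gt_eqF.
by rewrite d_sum0 mulr0.
Qed.

(** * Positivity and differentiability along trajectories *)

(** Shows that every factor of [traj_prod] sits on an edge, where the policies are assumed positive
    and differentiable. *)
Lemma all_zip_path (T : Type) (e : rel T) (s : T) (t : seq T) :
  all (fun a => e a.1 a.2) (zip (s :: t) t) = path e s t.
Proof. by elim: t s => //= y t IHt s; rewrite -IHt. Qed.

Lemma traj_prod_gt0 (R : realType) (G : pointedDAG) (P : G -> G -> R)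
    (t : seq G) :
  path edge init t -> (forall s s', edge s s' -> 0 < P s s') ->
  0 < traj_prod P t.
Proof.
rewrite -all_zip_path => /allP t_edges P_gt0; rewrite /traj_prod big_seq.
by apply: prodr_gt0 => a /t_edges; exact: P_gt0.
Qed.

Lemma differentiable_traj_prod (R : realType) (V : normedModType R)
    (G : pointedDAG) (P : V -> G -> G -> R) (x : V) (t : seq G) :
  path edge init t ->
  (forall s s', edge s s' -> differentiable (fun u => P u s s') x) ->
  differentiable (fun u => traj_prod (P u) t) x.
Proof.
rewrite -all_zip_path => /allP t_edges Pd.
by apply: differentiable_big_prod => a /t_edges; exact: Pd.
Qed.

Lemma total_reward_gt0 (R : realType) (G : pointedDAG) (r : G -> R) (x : G) :
  (forall x, terminating x -> 0 < r x) -> terminating x -> 0 < total_reward r.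
Proof.
move=> r_gt0 xX; rewrite /total_reward (bigD1 x)//=.
by rewrite ltr_pwDl ?r_gt0// sumr_ge0// => y /andP[/r_gt0/ltW].
Qed.

(** * The loss as a squared log ratio of the two laws *)

(** For [x <= 0] both sides are 0 by the default value of [ln]. *)
Lemma ln_inv (R : realType) (x : R) : ln x^-1 = - ln x.
Proof.
have [x_gt0|x_le0] := ltP 0 x; first by rewrite lnV ?posrE.
by rewrite !ln0 ?oppr0// invr_le0.
Qed.

Section LossAsLogRatio.
Variables (R : realType) (G : pointedDAG) (Z : R) (r : G -> R).
Variables (PF PB : G -> G -> R) (t : seq G).
Hypothesis r_neq0 : total_reward r != 0.

(** The total reward inside [backward_law] cancels against the one in the constant. As inverses of 0
    are 0, this holds for arbitrary [PF] and [PB], hence as an equality of functions of the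
    parameter, also outside the open parameter sets. *)
Lemma loss_TB_forward : loss_TB Z r PF PB t =
  ln (Z / total_reward r * (forward_law PF t / backward_law r PB t)) ^+ 2.
Proof.
rewrite /loss_TB /forward_law /backward_law invf_div; congr (ln _ ^+ 2).
set A := _ * traj_prod PB t; set N := total_reward r.
have -> : Z / N * (traj_prod PF t * (N / A)) = N / N * (Z * traj_prod PF t / A).
  by ring.
by rewrite divff// mul1r.
Qed.

(** Inverting the ratio flips the sign of the logarithm, which the square absorbs. *)
Lemma loss_TB_backward : loss_TB Z r PF PB t =
  ln (total_reward r / Z * (backward_law r PB t / forward_law PF t)) ^+ 2.
Proof.
by rewrite loss_TB_forward -sqrrN -ln_inv invfM !invf_div.
Qed.

End LossAsLogRatio.

Unset Implicit Arguments.

(** * The two gradient identities, first for a varying backward law, then for a varying forward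
    law *)

Theorem proposition1 (R : realType) (G : pointedDAG) (hG : graded G)
    (r : G -> R) (r_gt0 : forall x, terminating x -> 0 < r x)
    (p q : nat)
    (Theta : set 'rV[R]_p) (Theta_open : open Theta)
    (Phi : set 'rV[R]_q) (Phi_open : open Phi)
    (PF : 'rV[R]_p -> G -> G -> R) (PB : 'rV[R]_q -> G -> G -> R)
    (PF_policy : forall theta, Theta theta -> forward_policy (PF theta))
    (PB_policy : forall phi, Phi phi -> backward_policy (PB phi))
    (PF_gt0 : forall theta, Theta theta ->
       forall s s', edge s s' -> 0 < PF theta s s')
    (PB_gt0 : forall phi, Phi phi ->
       forall s s', edge s s' -> 0 < PB phi s s')
    (PF_diff : forall theta, Theta theta -> forall s s', edge s s' ->
       differentiable (fun u : 'rV[R]_p => PF u s s') theta)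
    (PB_diff : forall phi, Phi phi -> forall s s', edge s s' ->
       differentiable (fun u : 'rV[R]_q => PB u s s') phi)
    (Z : R) (Z_gt0 : 0 < Z)
    (theta : 'rV[R]_p) (htheta : Theta theta)
    (phi : 'rV[R]_q) (hphi : Phi phi) :
  [/\ differentiable (fun u : 'rV[R]_q =>
        KL (backward_law r (PB u)) (forward_law (PF theta))) phi,
      forall t, t \in trajectories G ->
        differentiable (fun u : 'rV[R]_q =>
          loss_TB Z r (PF theta) (PB u) t) phi
    & gradient (fun u : 'rV[R]_q =>
        KL (backward_law r (PB u)) (forward_law (PF theta))) phi
      = 2^-1 *: traj_expectation (backward_law r (PB phi)) (fun t =>
          gradient (fun u : 'rV[R]_q =>
            loss_TB Z r (PF theta) (PB u) t) phi)]
  /\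
  [/\ differentiable (fun u : 'rV[R]_p =>
        KL (forward_law (PF u)) (backward_law r (PB phi))) theta,
      forall t, t \in trajectories G ->
        differentiable (fun u : 'rV[R]_p =>
          loss_TB Z r (PF u) (PB phi) t) theta
    & gradient (fun u : 'rV[R]_p =>
        KL (forward_law (PF u)) (backward_law r (PB phi))) theta
      = 2^-1 *: traj_expectation (forward_law (PF theta)) (fun t =>
          gradient (fun u : 'rV[R]_p =>
            loss_TB Z r (PF u) (PB phi) t) theta)].
Proof.
have trajP t : t \in trajectories G ->
    path edge init (t : seq G) /\ terminating (last init (t : seq G)).
  by rewrite inE => /andP.
have N_gt0 : 0 < total_reward r.
  (* The forward law has mass 1, so its index set is nonempty; the end of any trajectory is then a
     state of positive reward. *)
  have [t tG] : exists t, t \in trajectories G.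
    apply/set0Pn/eqP => G0; have /esym/eqP := sum_forward_law (PF_policy _ htheta).
    by rewrite G0 big_set0 oner_eq0.
  by have [_ /(total_reward_gt0 r_gt0)] := trajP t tG.
have N_neq0 := lt0r_neq0 N_gt0.
have PFt_gt0 t : t \in trajectories G -> 0 < forward_law (PF theta) t.
  by move=> /trajP[t_path _]; exact: traj_prod_gt0 (PF_gt0 _ htheta).
have PBt_gt0 t : t \in trajectories G -> 0 < backward_law r (PB phi) t.
  move=> /trajP[t_path /r_gt0 rt_gt0]; rewrite divr_gt0// mulr_gt0//.
  exact: traj_prod_gt0 (PB_gt0 _ hphi).
split.
- have lossE t : (fun u : 'rV[R]_q => loss_TB Z r (PF theta) (PB u) t) =
      (fun u => ln (total_reward r / Z * (backward_law r (PB u) t / forward_law (PF theta) t)) ^+ 2).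
    by apply/funext => u; rewrite loss_TB_backward.
  have [||KLd lossd KLg] := @KL_gradient R G q (fun u => backward_law r (PB u))
      (forward_law (PF theta)) phi _ (divr_gt0 N_gt0 Z_gt0).
  + move=> t tG; split; [exact: PBt_gt0|exact: PFt_gt0|].
    have [t_path _] := trajP t tG.
    apply: differentiableM; last exact: differentiable_cst.
    apply: differentiableM; first exact: differentiable_cst.
    exact: differentiable_traj_prod (PB_diff _ hphi).
  (* Openness of [Phi] gives normalisation on a whole neighbourhood of [phi]. *)
  + apply: filterS (open_nbhs_nbhs (conj Phi_open hphi)) => u /PB_policy PBu.
    exact: sum_backward_law.
  split=> [//|t tG|].
    by rewrite lossE; exact: lossd.
  rewrite KLg; congr (_ *: traj_expectation _ _); apply/funext => t.
  by rewrite lossE.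
- have lossE t : (fun u : 'rV[R]_p => loss_TB Z r (PF u) (PB phi) t) =
      (fun u => ln (Z / total_reward r * (forward_law (PF u) t / backward_law r (PB phi) t)) ^+ 2).
    by apply/funext => u; rewrite loss_TB_forward.
  have [||KLd lossd KLg] := @KL_gradient R G p (fun u => forward_law (PF u))
      (backward_law r (PB phi)) theta _ (divr_gt0 Z_gt0 N_gt0).
  + move=> t tG; split; [exact: PFt_gt0|exact: PBt_gt0|].
    have [t_path _] := trajP t tG.
    exact: differentiable_traj_prod (PF_diff _ htheta).
  + apply: filterS (open_nbhs_nbhs (conj Theta_open htheta)) => u /PF_policy PFu.
    exact: sum_forward_law.
  split=> [//|t tG|].
    by rewrite lossE; exact: lossd.
  rewrite KLg; congr (_ *: traj_expectation _ _); apply/funext => t.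
  by rewrite lossE.
Qed.
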